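(* Let $\nu>0$, $\mathbf p\in\mathbb Z^2\setminus\{0\}$, and let $\mathbf q\in\mathcal Q(\mathbf p)$ be of type $I_0$ and not parallel to $\mathbf p$. If $\lambda>0$ is a root of the equation $$a_0(\lambda,\nu)+f(\lambda,\nu)+g(\lambda,\nu)=0,\qquad(\ast)$$ then $\det(I+K_\lambda)=0$. In addition, if $\lambda>0$ is an eigenvalue of the operator $L_{B,\mathbf q}$ with eigenvector $(w_n)$ satisfying the sign property (S), then $\lambda$ is a root of $(\ast)$ if and only if $\det(I+K_\lambda)=0$.
   Context: $\|\cdot\|$ is the Euclidean norm. For $\mathbf q\in\mathbb Z^2$ let $\Sigma_{\mathbf q}=\{\mathbf q+n\mathbf p:n\in\mathbb Z\}$, let $\widehat{\mathbf q}$ be the point of smallest norm in $\Sigma_{\mathbf q}$ (if there are two, the one with larger $n$), and $\mathcal Q(\mathbf p)=\{\widehat{\mathbf q}:\mathbf q\in\mathbb Z^2\}$. A point $\mathbf q\in\mathcal Q(\mathbf p)$ is of type $I_0$ if $\mathbf q$ is the only point of $\Sigma_{\mathbf q}$ in the open disk of radius $\|\mathbf p\|$ centered at $0$ and $\|\mathbf q\pm\mathbf p\|>\|\mathbf p\|$. Set $\rho_n=1-\frac{\|\mathbf p\|^2}{\|\mathbf q+n\mathbf p\|^2}$; for type $I_0$, $\rho_0<0$ and $\rho_n>0$ for $n\ne0$. $L_{B,\mathbf q}$ is the unbounded operator in $\ell^2(\mathbb Z)$, with domain the sequences such that $(n^2w_n)\in\ell^2(\mathbb Z)$, given by $$L_{B,\mathbf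 q}:(w_n)_{n\in\mathbb Z}\mapsto(\rho_{n-1}w_{n-1}-\rho_{n+1}w_{n+1}-\nu\|\mathbf q+n\mathbf p\|^2w_n)_{n\in\mathbb Z}.$$ (This is the restriction to Fourier modes $\mathbf q+n\mathbf p$ of the 2D Navier-Stokes vorticity operator linearized about $\omega^0=\Gamma\cos(\mathbf p\cdot\mathbf x)$, with $\Gamma$ normalized by $\Gamma(\mathbf q\wedge\mathbf p)/(2\|\mathbf p\|^2)=1$, where $\mathbf q\wedge\mathbf p=q_1p_2-q_2p_1$.) Continued fractions: $[c_1;c_2;\ldots]=\cfrac{1}{c_1+\cfrac{1}{c_2+\cdots}}$. $a_n(\lambda,\nu)=\frac{\lambda+\nu\|\mathbf q+n\mathbf p\|^2}{\rho_n}$, $f(\lambda,\nu)=[a_1;a_2;\ldots]$, $g(\lambda,\nu)=[a_{-1};a_{-2};\ldots]$. Let $S:(w_n)\mapsto(w_{n-1})$ be the shift on $\ell^2(\mathbb Z)$ and $S^*$ its adjoint. For $\lambda>0$, $K_\lambda=\operatorname{diag}\{(-\nu\|\mathbf q+n\mathbf p\|^2-\lambda)^{-1}\}(S-S^* )\operatorname{diag}\{\rho_n\}$, a trace class operator on $\ell^2(\mathbb Z)$; $\det(I+K_\lambda)=\prod_n(1+\kappa^n_\lambda)$ is its Fredholm determinant, the product being over all eigenvalues $\kappa^n_\lambda$ of $K_\lambda$ (counted with algebraic multiplicity). Sign property (S): either $w_n>0$ for $n>0$, $w_n<0$ for $n=-1,0$, and $(-1)^{|n|}w_n>0$ for $n\le-2$;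 or the entries of $(-w_n)$ satisfy these inequalities. *)

(* Defs.v *)
From HB Require Import structures.
From mathcomp Require Import all_boot all_order all_algebra.
From mathcomp Require Import finmap.
From mathcomp Require Import all_classical all_reals all_analysis.
From mathcomp Require Import complex.
(* [totally], the filter of large finite subsets *)
From mathcomp.analysis.showcase Require summability.

Set Implicit Arguments.
Unset Strict Implicit.
Unset Printing Implicit Defensive.

Import Order.TTheory GRing.Theory Num.Theory.
Import numFieldNormedType.Exports.

Local Open Scope classical_set_scope.
Local Open Scope ring_scope.
Local Open Scope complex_scope.

Section Lattice.
Variable R : realType.
Implicit Types p q x : int * int.

(* The Euclidean norm; mathcomp's own [`|x|] on pairs is the sup norm. *)
Definition enorm x : R := Num.sqrt ((x.1)%:~R ^+ 2 + (x.2)%:~R ^+ 2).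

Definition parallel q p : Prop :=
  exists t : R, (q.1)%:~R = t * (p.1)%:~R /\ (q.2)%:~R = t * (p.2)%:~R.

Definition Sigma p q : set (int * int) :=
  [set q + p *~ n | n in [set: int]].

(* [x] is the representative of [Sigma p q] written q-hat: [n] minimizes the
   norm of [q + p *~ n] and is the largest minimizer. *)
Definition is_hat p q x : Prop :=
  exists n : int, x = q + p *~ n /\
    forall m : int,
      enorm (q + p *~ n) <= enorm (q + p *~ m) /\
      (enorm (q + p *~ m) = enorm (q + p *~ n) -> m <= n).

Definition Qset p : set (int * int) := [set x | exists q, is_hat p q x].

Definition type_I0 p q : Prop :=
  [/\ Sigma p q `&` [set x | enorm x < enorm p] = [set q],
      enorm p < enorm (q + p) & enorm p < enorm (q - p)].

End Lattice.

Section ContinuedFraction.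
Variable R : realType.

(* [cfrac_trunc c N] is [1/(c 0 + 1/(c 1 + ... + 1/c (N-1)))]. *)
Fixpoint cfrac_trunc (c : nat -> R) (N : nat) : R :=
  if N is N'.+1 then 1 / (c 0%N + cfrac_trunc (fun k => c k.+1) N') else 0.

Definition cfrac (c : nat -> R) : R := lim (cfrac_trunc c @ \oo).

End ContinuedFraction.

Section Operators.
Variable R : realType.
Local Notation seqZ := (int -> R[i]).
Implicit Types w : seqZ.

Definition ell2 : set seqZ :=
  [set w | (\esum_(n in [set: int]) ((Normc.normc (w n)) ^+ 2)%:E < +oo)%E].

Definition is_eigenvector (D : set seqZ) (T : seqZ -> seqZ) (z : R[i]) w :=
  [/\ D w, w <> 0 & T w = z *: w].

(* [V] is meant to be a linear subspace. *)
Definition has_dim (V : set seqZ) (m : nat) : Prop :=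
  exists v : 'I_m -> seqZ,
    [/\ forall i, V (v i),
        forall c : 'I_m -> R[i],
          \sum_(i < m) c i *: v i = 0 -> forall i, c i = 0
      & forall w, V w -> exists c : 'I_m -> R[i], w = \sum_(i < m) c i *: v i].

(* For an operator [T] defined on all of [ell2]. *)
Definition gen_eigenspace (T : seqZ -> seqZ) (z : R[i]) : set seqZ :=
  [set w | ell2 w /\ exists k, iter k (fun u => T u - z *: u) w = 0].

Definition alg_mult (T : seqZ -> seqZ) (z : R[i]) (m : nat) : Prop :=
  has_dim (gen_eigenspace T z) m.

(* [d] is the Fredholm determinant of [I + T], that is the product of
   [1 + z] over the eigenvalues [z] of [T] repeated according to their
   algebraic multiplicity.  The product is the limit over the finite sets of
   complex numbers ordered by inclusion, so it does not depend on an
   enumeration; a [z] which is not an eigenvalue has multiplicity 0 and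
   contributes the factor 1.  The point 0 would also contribute 1, and is left
   out because its multiplicity may be infinite.  The relation fails if some
   nonzero multiplicity is infinite or if the product diverges. *)
Definition is_fredholm_det (T : seqZ -> seqZ) (d : R[i]) : Prop :=
  exists m : R[i] -> nat,
    (forall z, z != 0 -> alg_mult T z (m z)) /\
    (fun A : {fset R[i]} => \prod_(z <- A | z != 0) (1 + z) ^+ m z : R[i]^o)
      @ @summability.totally R[i] --> (d : R[i]^o).

Definition diag (d : int -> R) w : seqZ := fun n => (d n)%:C * w n.

Definition shift w : seqZ := fun n => w (n - 1).

(* The adjoint of [shift], which is unitary, is its inverse. *)
Definition shift_adj w : seqZ := fun n => w (n + 1).

End Operators.

Section Problem.
Variables (R : realType) (p q : int * int) (nu : R).
Local Notation seqZ := (int -> R[i]).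
Implicit Types (w : seqZ) (n : int) (lambda : R).

Definition mode_norm2 n : R := enorm R (q + p *~ n) ^+ 2.

Definition rho n : R := 1 - enorm R p ^+ 2 / mode_norm2 n.

Definition dom_LB : set seqZ :=
  [set w | ell2 w /\ ell2 (fun n => (n%:~R) ^+ 2 * w n)].

Definition LB w : seqZ := fun n =>
  (rho (n - 1))%:C * w (n - 1) - (rho (n + 1))%:C * w (n + 1)
  - (nu * mode_norm2 n)%:C * w n.

Definition acoef lambda n : R := (lambda + nu * mode_norm2 n) / rho n.

Definition fcf lambda : R := cfrac (fun k => acoef lambda (k.+1)%:Z).

Definition gcf lambda : R := cfrac (fun k => acoef lambda (- (k.+1)%:Z)).

Definition Kop lambda w : seqZ :=
  let u := diag rho w in
  diag (fun n => (- nu * mode_norm2 n - lambda)^-1) (shift u - shift_adj u).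

(* On R[i], [0 < z] means that [z] is real and positive. *)
Definition sign_ineqs w : Prop :=
  [/\ forall n, 0 < n -> 0 < w n,
      w (-1) < 0, w 0 < 0
    & forall n, n <= -2 -> 0 < (-1) ^+ `|n|%N * w n].

Definition sign_property w : Prop := sign_ineqs w \/ sign_ineqs (- w).

End Problem.

(* Main.v *)
Require Import Defs.
From mathcomp Require Import all_boot all_order all_algebra.
From mathcomp Require Import finmap.
From mathcomp Require Import all_classical all_reals all_analysis.
From mathcomp Require Import complex.
From mathcomp Require Import zify ring lra.
Import Order.TTheory GRing.Theory Num.Theory.
Local Open Scope classical_set_scope.
Local Open Scope ring_scope.
Local Open Scope complex_scope.

Set Implicit Arguments.
Unset Strict Implicit.
Unset Printing Implicit Defensive.
Import numFieldNormedType.Exports.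

(** Substituting z_n = rho_n w_n turns both K w = - w and the eigenvalue
    equation of the linearized operator at lambda into the scalar recurrence
      z_(n-1) - z_(n+1) = a_n z_n,
    so the theorem is about bounded solutions of that recurrence.

    Since rho_n lies in (0, 1) away from n = 0, one has a_n >= lambda there, and
    continued fractions with entries bounded below by a positive constant
    converge, because two consecutive steps form a uniform contraction
    ([two_step_contraction]).  On the half-line n > 0 the successive tails of
    f are the ratios z_(n+1) / z_n of a positive bounded solution; on n < 0
    the tails of g are the ratios up to an alternating sign.  The two half-line
    solutions fit together at n = 0 exactly when a_0 + f + g = 0
    ([bounded_solution_of_root]).  A bounded z gives
    w_n = (z_(n-1) - z_(n+1)) / (nu |q + n p|^2 + lambda) = O(n^-2), so w is
    square summable and - 1 is an eigenvalue of K.  Conversely, the sign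
    property says precisely that the ratios on both half-lines have the sign of
    the continued fractions, and a positive sequence satisfying the continued
    fraction recursion is unique ([cfrac_unique]); hence an eigenvector with
    that property forces the root equation ([root_of_signed_eigenvector]).

    When - 1 is an eigenvalue, every finite product over a set containing - 1
    has a vanishing factor, so the product of the 1 + z converges to 0 without
    any estimate on the other eigenvalues ([fredholm_det_eq0]).  What the
    determinant does require is that all generalized eigenspaces at z <> 0 be
    finite dimensional ([tridiag_alg_mult]).  The kernel of (K - z)^k consists
    of solutions of a recurrence of order 2 k, so it is determined by 2 k
    consecutive entries; and the chain of these kernels is stationary by Riesz's
    argument for compact operators, carried out in the sup norm: the rows of K
    decay, so up to a small error K only sees finitely many bounded entries, to
    which the pigeonhole principle applies. *)

(** * Complex modulus and square summable sequences *)

Section ComplexModulus.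
Context {R : realType}.
Implicit Types z : R[i].
Local Notation normc := (@Normc.normc R).

Lemma normc_ge0 z : 0 <= normc z.
Proof. by case: z => a b; apply: sqrtr_ge0. Qed.

Lemma normcD z1 z2 : normc (z1 + z2) <= normc z1 + normc z2.
Proof. exact: (@le_normcD R z1 z2). Qed.

Lemma normcB z1 z2 : normc (z1 - z2) <= normc z1 + normc z2.
Proof. by rewrite -[normc z2](@normcN R z2); apply: normcD. Qed.

Lemma normc_realM (a : R) z : normc (a%:C * z) = `|a| * normc z.
Proof. by rewrite Normc.normcM /= expr0n addr0 sqrtr_sqr. Qed.

Lemma normc_gt0 z : (0 < normc z) = (z != 0).
Proof.
rewrite lt_neqAle normc_ge0 andbT eq_sym; congr negb.
apply/eqP/eqP => [/Normc.eq0_normc //|->]; exact: Normc.normc0.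
Qed.

Lemma Re_le_normc z : `|complex.Re z| <= normc z.
Proof.
case: z => a b /=; rewrite -sqrtr_sqr ler_wsqrtr//.
by rewrite lerDl sqr_ge0.
Qed.

Lemma Im_le_normc z : `|complex.Im z| <= normc z.
Proof.
case: z => a b /=; rewrite -sqrtr_sqr ler_wsqrtr//.
by rewrite lerDr sqr_ge0.
Qed.

Lemma normc_le_ReIm z : normc z <= `|complex.Re z| + `|complex.Im z|.
Proof.
case: z => a b /=; rewrite -ler_sqr ?nnegrE ?sqrtr_ge0 ?addr_ge0 //.
rewrite sqr_sqrtr ?addr_ge0 ?sqr_ge0// sqrrD !real_normK ?num_real//.
by rewrite -addrA lerD2l lerDr mulrn_wge0 // mulr_ge0.
Qed.

End ComplexModulus.

Section SquareSummable.
Context {R : realType}.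
Implicit Types w : int -> R[i].
Local Notation normc := (@Normc.normc R).

Lemma ell2_bounded w : ell2 w -> exists B : R, forall n, normc (w n) <= B.
Proof.
rewrite /ell2 /= => wfin.
set S := esum _ _ in wfin.
have term n : ((normc (w n) ^+ 2)%:E <= S)%E.
  apply: esum_ge; exists [set n]; first by split.
  by rewrite fsbig_set1.
have S_ge0 : (0 <= S)%E by apply: esum_ge0 => n _; rewrite lee_fin sqr_ge0.
exists (1 + fine S) => n.
have := term n; rewrite -[S]fineK ?ge0_fin_numE// lee_fin => le_n.
have := normc_ge0 (w n); nra.
Qed.

(** The bound telescopes: 1 / (1 + (N + 1)^2) is at most
    2 / (N + 1) - 2 / (N + 2). *)
Lemma inv_square_partial_sum N :
  \sum_(0 <= k < N.+1) (1 + k%:R ^+ 2)^-1 <= 3 - 2 / N.+1%:R :> R.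
Proof.
elim: N => [|N IHN]; first by rewrite big_nat1 expr0n addr0 invr1; lra.
rewrite big_nat_recr//=; apply: (le_trans (lerD IHN (lexx _))).
rewrite -[N.+2]addn1 -[N.+1]addn1 !natrD.
have : 0 <= N%:R :> R by [].
move: (N%:R : R) => x x0.
have d1 : 0 < 1 + (x + 1) ^+ 2 by nra.
have -> : 3 - 2 / (x + 1) + (1 + (x + 1) ^+ 2)^-1 =
  3 - 2 / (x + 1 + 1) - (x ^+ 2 + x + 2) / ((1 + (x + 1) ^+ 2) * (x + 1) * (x + 1 + 1)).
  field; do ?[apply/andP; split]; by rewrite lt0r_neq0 //; nra.
rewrite gerBl divr_ge0 //; first nra.
by rewrite !mulr_ge0 //; nra.
Qed.

Lemma esum_inv_square_lty (c : R) : 0 <= c ->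
  (\esum_(k in [set: nat]) (c * (1 + k%:R ^+ 2)^-1)%:E < +oo)%E.
Proof.
move=> c0; have t0 k : 0 <= c * (1 + k%:R ^+ 2)^-1.
  by rewrite mulr_ge0 // invr_ge0 addr_ge0 // sqr_ge0.
rewrite -nneseries_esumT; last by move=> k; rewrite lee_fin.
apply: (@le_lt_trans _ _ (c * 3)%:E); last exact: ltry.
apply: lime_le; first by apply: is_cvg_nneseries => k _ _; rewrite lee_fin.
apply: nearW => N; rewrite sumEFin lee_fin -mulr_sumr ler_wpM2l //.
case: N => [|N]; first by rewrite big_nil.
apply: (le_trans (inv_square_partial_sum N)).
by rewrite gerBl divr_ge0.
Qed.

(** Decay like n^-2 is more than enough, and it is what a bounded solution
    of the recurrence yields after division by nu |q + n p|^2 + lambda. *)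
Lemma ell2_decay w (B : R) :
  (forall n : int, (1 + n%:~R ^+ 2) * normc (w n) <= B) -> ell2 w.
Proof.
move=> wB; rewrite /ell2 /=.
have B0 : 0 <= B.
  by apply: le_trans (wB 0); rewrite mulr_ge0 ?normc_ge0 ?addr_ge0 ?sqr_ge0.
have sqw n : normc (w n) ^+ 2 <= B ^+ 2 * (1 + n%:~R ^+ 2)^-1.
  have := wB n; have := normc_ge0 (w n); move: (normc _) => x x0.
  have : 0 <= n%:~R ^+ 2 :> R by rewrite sqr_ge0.
  move: (n%:~R ^+ 2 : R) => y y0 xB.
  rewrite ler_pdivlMr; last lra.
  apply: (@le_trans _ _ (((1 + y) * x) ^+ 2)).
    by rewrite exprMn mulrC ler_wpM2r ?sqr_ge0 // expr2 ler_peMr //; lra.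
  by rewrite ler_sqr // nnegrE mulr_ge0 //; lra.
rewrite (esumID (range Posz)); last by move=> n _; rewrite lee_fin sqr_ge0.
rewrite setTI setTI.
have -> : ~` range Posz = range Negz.
  apply/seteqP; split => [[n|n] /= Hn|_ [n _ <-] [m _ //]].
    by case: Hn; exists n.
  by exists n.
rewrite !esum_image; try by move=> m n _ _ [].
have fin := esum_inv_square_lty (sqr_ge0 B).
apply: lte_add_pinfty; apply: (@le_lt_trans _ _ _ _ _ _ fin).
  by apply: le_esum => k _; rewrite lee_fin; apply: sqw.
apply: le_esum => k _; rewrite lee_fin; apply: le_trans (sqw _) _.
rewrite ler_wpM2l ?sqr_ge0 // lef_pV2 ?posrE ?ltr_wpDr ?sqr_ge0 //.
by rewrite lerD2l NegzE rmorphN sqrrN /= -pmulrn ler_sqr ?nnegrE // ler_nat.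
Qed.

End SquareSummable.

(** * Continued fractions with entries bounded below *)

Section PositiveContinuedFractions.
Context {R : realType}.
Implicit Types (c : nat -> R) (d : R).
Local Notation tl c := (fun k => c k.+1).

Lemma cfrac_trunc_ge0 N c : (forall k, 0 < c k) -> 0 <= cfrac_trunc c N.
Proof.
elim: N c => [|N IHN] c c0 //=.
by rewrite div1r invr_ge0 addr_ge0 ?IHN // ltW.
Qed.

Lemma cfrac_trunc_le N c d : 0 < d -> (forall k, d <= c k) ->
  cfrac_trunc c N <= d^-1.
Proof.
move=> d0 dc; have cp k : 0 < c k := lt_le_trans d0 (dc k).
case: N => [|N] /=; first by rewrite invr_ge0 ltW.
have t0 := cfrac_trunc_ge0 N (fun k => cp k.+1).
by rewrite div1r lef_pV2 ?posrE ?ltr_wpDr // ler_wpDr.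
Qed.

(** A single step x |-> 1 / (a + x) need not contract when a is small.
    The derivative of the double step is (a b + a x + 1)^-2, which is bounded
    away from 1. *)
Lemma two_step_contraction (a b d x y : R) : 0 < d -> d <= a -> d <= b ->
  0 <= x -> 0 <= y ->
  `|1 / (a + 1 / (b + x)) - 1 / (a + 1 / (b + y))|
    <= (1 + d ^+ 2)^-1 * `|x - y|.
Proof.
move=> d0 da db x0 y0.
have a0 : 0 < a by lra.
have b0 : 0 < b by lra.
have dab : d ^+ 2 <= a * b by rewrite expr2 ler_pM // ltW.
have ax : 0 <= a * x by rewrite mulr_ge0 // ltW.
have ay : 0 <= a * y by rewrite mulr_ge0 // ltW.
have sq0 := sqr_ge0 d.
pose X := a * b + a * x + 1; pose Y := a * b + a * y + 1.
have X0 : 0 < X by rewrite /X; lra.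
have Y0 : 0 < Y by rewrite /Y; lra.
have step z : 0 <= z -> 1 / (a + 1 / (b + z)) = (b + z) / (a * b + a * z + 1).
  move=> z0; have az : 0 <= a * z by rewrite mulr_ge0 // ltW.
  by field; rewrite !lt0r_neq0 //; lra.
rewrite !step // -/X -/Y.
have -> : (b + x) / X - (b + y) / Y = (X * Y)^-1 * (x - y).
  rewrite /X /Y; field; rewrite -/X -/Y.
  by rewrite !lt0r_neq0.
have XY0 : 0 < X * Y by rewrite mulr_gt0.
rewrite normrM ler_wpM2r // gtr0_norm ?invr_gt0 //.
rewrite lef_pV2 ?posrE //; last by lra.
apply: (@le_trans _ _ (1 * Y)); first by rewrite mul1r /Y; lra.
by rewrite ler_wpM2r ?(ltW Y0) // /X; lra.
Qed.

Lemma contraction_power_small d e : 0 < d -> 0 < e ->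
  exists N : nat, (1 + d ^+ 2)^-1 ^+ N * d^-1 < e.
Proof.
move=> d0 e0; have q1 : `|(1 + d ^+ 2)^-1| < 1.
  have d20 : 0 < d ^+ 2 by rewrite exprn_gt0.
  by rewrite gtr0_norm ?invr_gt0 ?invf_lt1; lra.
have /cvgrPdist_lt /(_ (e * d)) := cvg_expr q1.
case; first by rewrite mulr_gt0.
move=> N _ /(_ N (leqnn N)); rewrite sub0r normrN => qN.
by exists N; rewrite ltr_pdivrMr // (le_lt_trans (ler_norm _)).
Qed.

(** Two truncations that share their first 2 N entries differ only in the
    argument fed to N double steps, and both arguments lie in [0, 1/d]. *)
Lemma cfrac_trunc_contract N c d m m' :
  0 < d -> (forall k, d <= c k) ->
  `|cfrac_trunc c (N.*2 + m) - cfrac_trunc c (N.*2 + m')|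
    <= (1 + d ^+ 2)^-1 ^+ N * d^-1.
Proof.
move=> d0; elim: N c => [|N IHN] c dc.
  have cp k : 0 < c k := lt_le_trans d0 (dc k).
  rewrite expr0 mul1r !add0n ler_norml.
  have := cfrac_trunc_ge0 m cp; have := cfrac_trunc_ge0 m' cp.
  have := cfrac_trunc_le m d0 dc; have := cfrac_trunc_le m' d0 dc; lra.
have cp k : 0 < c k := lt_le_trans d0 (dc k).
rewrite doubleS !addSn; apply: le_trans (two_step_contraction d0 _ _ _ _) _ => //.
- by apply: cfrac_trunc_ge0 => k.
- by apply: cfrac_trunc_ge0 => k.
rewrite [_ ^+ N.+1]exprS -mulrA ler_wpM2l //; last exact: IHN.
by rewrite invr_ge0 addr_ge0 ?sqr_ge0.
Qed.

Lemma cfrac_cvg c d : 0 < d -> (forall k, d <= c k) ->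
  cvg (cfrac_trunc c @ \oo).
Proof.
move=> d0 dc; apply/cauchy_cvgP/cauchy_exP => e e0.
have [N qN] := contraction_power_small d0 e0.
exists (cfrac_trunc c (N.*2)), N.*2 => // m /= Nm.
rewrite -ball_normE /= -[X in cfrac_trunc c X - _]addn0 -(subnKC Nm).
exact: le_lt_trans (cfrac_trunc_contract _ _ _ d0 dc) qN.
Qed.

Lemma cfrac_rec c d : 0 < d -> (forall k, d <= c k) ->
  cfrac c = 1 / (c 0%N + cfrac (tl c)).
Proof.
move=> d0 dc; have cp k : 0 < c k := lt_le_trans d0 (dc k).
have cv' := cfrac_cvg d0 (fun k => dc k.+1).
have t0 : 0 <= cfrac (tl c).
  by apply: limr_ge => //; apply: nearW => N; apply: cfrac_trunc_ge0.
rewrite {1}/cfrac.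
apply/cvg_lim => //; rewrite -(cvg_shiftS (cfrac_trunc c)) /=.
under eq_fun do rewrite div1r; rewrite div1r.
apply: cvgV; first by rewrite lt0r_neq0 // ltr_wpDr.
by apply: cvgD => //; apply: cvg_cst.
Qed.

Lemma cfrac_ge0 c d : 0 < d -> (forall k, d <= c k) -> 0 <= cfrac c.
Proof.
move=> d0 dc; have cp k : 0 < c k := lt_le_trans d0 (dc k).
apply: limr_ge; first exact: cfrac_cvg dc.
by apply: nearW => N; apply: cfrac_trunc_ge0.
Qed.

Lemma cfrac_gt0 c d : 0 < d -> (forall k, d <= c k) -> 0 < cfrac c.
Proof.
move=> d0 dc; rewrite (cfrac_rec d0 dc) div1r invr_gt0.
by rewrite ltr_pwDl ?(lt_le_trans d0) // (cfrac_ge0 d0).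
Qed.

(** The tails of the continued fraction satisfy the same recursion as [r], and
    both are bounded by 1/d, so N double steps bring them within a geometric
    distance of each other. *)
Lemma cfrac_unique (r c : nat -> R) d : 0 < d -> (forall k, d <= c k) ->
  (forall k, 0 < r k) -> (forall k, r k = 1 / (c k + r k.+1)) ->
  r 0%N = cfrac c.
Proof.
move=> d0 dc r0 rE.
pose F k := cfrac (fun j => c (j + k)%N).
have dck k j : d <= c (j + k)%N by [].
have F0 k : 0 <= F k by apply: cfrac_ge0 d0 (dck k).
have FE k : F k = 1 / (c k + F k.+1).
  rewrite /F (cfrac_rec d0 (dck k)) add0n.
  by congr (1 / (c k + cfrac _)); apply: funext => j; rewrite addnS.
have small (u : nat -> R) k : (forall k, 0 <= u k) ->
    (forall k, u k = 1 / (c k + u k.+1)) -> u k <= d^-1.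
  move=> u0 uE; rewrite uE div1r lef_pV2 ?posrE //; first by rewrite ler_wpDr.
  by rewrite ltr_wpDr // (lt_le_trans d0).
have rF N k : `|r k - F k| <= (1 + d ^+ 2)^-1 ^+ N * d^-1.
  elim: N k => [|N IHN] k.
    rewrite expr0 mul1r ler_norml.
    have := small r k (fun k => ltW (r0 k)) rE; have := small F k F0 FE.
    have := r0 k; have := F0 k; lra.
  rewrite rE (rE k.+1) (FE k) (FE k.+1).
  apply: le_trans (two_step_contraction d0 (dc _) (dc _) (ltW (r0 _)) (F0 _)) _.
  rewrite [_ ^+ N.+1]exprS -mulrA ler_wpM2l //.
  by rewrite invr_ge0 addr_ge0 ?sqr_ge0.
have -> : cfrac c = F 0%N.
  by congr cfrac; apply: funext => j; rewrite addn0.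
apply/eqP; rewrite -subr_eq0 -normr_le0; apply/ler_addgt0Pl => e e0.
rewrite addr0.
have [N qN] := contraction_power_small d0 e0.
exact: le_trans (rF N 0%N) (ltW qN).
Qed.

End PositiveContinuedFractions.

(** * The lattice and the coefficients rho *)

Section LatticeNorms.
Context {R : realType} (p q : int * int).
Local Notation mode := (@mode_norm2 R p q).
Local Notation rho := (@rho R p q).

Lemma enorm_sq (x : int * int) :
  enorm R x ^+ 2 = (x.1)%:~R ^+ 2 + (x.2)%:~R ^+ 2.
Proof. by rewrite sqr_sqrtr // addr_ge0 ?sqr_ge0. Qed.

Lemma enorm_ge0 (x : int * int) : 0 <= enorm R x.
Proof. exact: sqrtr_ge0. Qed.

Lemma mulpair (n : int) : p *~ n = (p.1 * n, p.2 * n).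
Proof.
have add2 (x : int * int) (k : nat) : x *+ k = (x.1 *+ k, x.2 *+ k).
  elim: k => [|k IHk]; first by rewrite !mulr0n.
  by rewrite !mulrS IHk.
case: n => n.
  by rewrite -pmulrn add2 -!mulrzz -!pmulrn.
by rewrite NegzE mulrNz -pmulrn add2 !mulrN -!mulrzz -!pmulrn.
Qed.

Lemma mode_norm2E n : mode n =
  ((q.1)%:~R + (p.1)%:~R * n%:~R) ^+ 2 + ((q.2)%:~R + (p.2)%:~R * n%:~R) ^+ 2.
Proof. by rewrite /mode_norm2 enorm_sq mulpair /= !rmorphD !rmorphM. Qed.

Lemma mode_norm2_gt0 n : ~ parallel R q p -> 0 < mode n.
Proof.
move=> npar; rewrite lt_neqAle sqr_ge0 andbT eq_sym; apply/eqP => m0.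
apply: npar; exists (- n%:~R); move/eqP: m0.
rewrite mode_norm2E paddr_eq0 ?sqr_ge0 // !sqrf_eq0 => /andP[/eqP e1 /eqP e2].
by split; lra.
Qed.

Hypothesis q_type : type_I0 R p q.

Lemma enorm_q_lt : enorm R q < enorm R p.
Proof.
case: q_type => E _ _.
by have : [set q] q by []; rewrite -E => -[].
Qed.

(** The type only constrains n = 1 and n = - 1; convexity of
    n |-> |q + n p|^2 carries the strict bound to all other n. *)
Lemma enorm2_lt_mode (n : int) : n != 0 -> enorm R p ^+ 2 < mode n.
Proof.
move=> n0; case: q_type => _ qDp qBp.
have lt2 x : enorm R p < enorm R x -> enorm R p ^+ 2 < enorm R x ^+ 2.
  by rewrite ltr_sqr ?nnegrE ?enorm_ge0.
have := lt2 _ qDp; have := lt2 _ qBp.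
rewrite mode_norm2E !enorm_sq /= !(rmorphD, rmorphN) /=.
set p1 : R := p.1%:~R; set p2 : R := p.2%:~R.
set q1 : R := q.1%:~R; set q2 : R := q.2%:~R.
move=> Bm Bp.
have qp : q1 ^+ 2 + q2 ^+ 2 < p1 ^+ 2 + p2 ^+ 2.
  have : enorm R q ^+ 2 < enorm R p ^+ 2.
    by rewrite ltr_sqr ?nnegrE ?enorm_ge0 // enorm_q_lt.
  by rewrite !enorm_sq.
set P := p1 ^+ 2 + p2 ^+ 2 in qp Bm Bp *.
set Q := q1 * p1 + q2 * p2; set N := q1 ^+ 2 + q2 ^+ 2 in qp *.
have {}Bm : 0 < N - 2 * Q by rewrite /N /Q /P in Bm *; lra.
have {}Bp : 0 < N + 2 * Q by rewrite /N /Q /P in Bp *; lra.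
have -> : (q1 + p1 * n%:~R) ^+ 2 + (q2 + p2 * n%:~R) ^+ 2 =
    N + 2 * n%:~R * Q + n%:~R ^+ 2 * P by rewrite /N /P /Q; ring.
move: (Q) Bm Bp => {}Q Bm Bp.
have P0 : 0 <= P by rewrite addr_ge0 ?sqr_ge0.
have PN : 0 <= P - N by lra.
(* For x >= 1 all summands are nonnegative, and the first is positive, in
     |q + x p|^2 - |p|^2 = x (|q|^2 + 2 q.p) + x (x - 1) |p|^2
                           + (x - 1) (|p|^2 - |q|^2);
   x <= - 1 is symmetric. *)
have [npos|nneg] : 1 <= n \/ n <= -1 by lia.
  have := npos; rewrite -(ler_int R); move: (n%:~R : R) => x x1.
  have := mulr_gt0 (lt_le_trans ltr01 x1) Bp.
  have x10 : 0 <= x - 1 by lra.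
  have := mulr_ge0 (mulr_ge0 (le_trans ler01 x1) x10) P0.
  have := mulr_ge0 x10 PN; lra.
have := nneg; rewrite -(ler_int R); move: (n%:~R : R) => x x1.
have x0 : 0 < - x by lra.
have x10 : 0 <= - x - 1 by lra.
have := mulr_gt0 x0 Bm.
have := mulr_ge0 (mulr_ge0 (ltW x0) x10) P0.
have := mulr_ge0 x10 PN; lra.
Qed.

Hypothesis p_neq0 : p <> 0.

Lemma enorm2_p_ge1 : 1 <= enorm R p ^+ 2.
Proof.
have -> : enorm R p ^+ 2 = (p.1 ^+ 2 + p.2 ^+ 2)%:~R.
  by rewrite enorm_sq intrD !expr2 !intrM.
rewrite -[1]/(1%:~R) ler_int.
rewrite -gtz0_ge1.
have [/eqP p1|p1] := boolP (p.1 == 0); last first.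
  by apply: ltr_wpDr; rewrite ?sqr_ge0 ?exprn_even_gt0.
have [/eqP p2|p2] := boolP (p.2 == 0); last first.
  by apply: ltr_wpDl; rewrite ?sqr_ge0 ?exprn_even_gt0.
by case: p_neq0; move: p1 p2; case: (p) => /= a b -> ->.
Qed.

Lemma rho_in01 n : n != 0 -> 0 < rho n < 1.
Proof.
move=> n0; have := enorm2_lt_mode n0; have := enorm2_p_ge1.
rewrite /rho; move: (_ ^+ 2) (mode n) => P M P1 PM.
have M0 : 0 < M by lra.
by rewrite subr_gt0 gtrBl ltr_pdivrMr // mul1r PM divr_gt0 //; lra.
Qed.

Hypothesis q_nparallel : ~ parallel R q p.

Lemma rho0_lt0 : rho 0 < 0.
Proof.
have := @mode_norm2_gt0 0 q_nparallel.
rewrite /rho; have -> : mode 0 = enorm R q ^+ 2 by rewrite /mode_norm2 mulr0z addr0.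
move=> q0; rewrite subr_lt0 ltr_pdivlMr // mul1r.
by rewrite ltr_sqr ?nnegrE ?enorm_ge0 // enorm_q_lt.
Qed.

Lemma rho_neq0 n : rho n != 0.
Proof.
have [->|n0] := eqVneq n 0; first by rewrite lt_eqF // rho0_lt0.
by rewrite gt_eqF //; case/andP: (rho_in01 n0).
Qed.

Lemma rho_bounded : exists M : R, forall n, `|rho n| <= M.
Proof.
exists (1 + `|rho 0|) => n.
have [->|n0] := eqVneq n 0; first by rewrite lerDr.
have /andP[r0 r1] := rho_in01 n0.
by rewrite gtr0_norm // ler_wpDr // ltW.
Qed.

(** The quadratic |q + n p|^2 is at least n^2 / 2 - |q|^2, and
    nu |q + n p|^2 + lambda never falls below lambda; a multiple of the latter
    absorbs the constant. *)
Lemma mode_growth (nu lambda : R) : 0 < nu -> 0 < lambda ->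
  exists2 C, 0 < C & forall n : int,
    1 + n%:~R ^+ 2 <= C * (nu * mode n + lambda).
Proof.
move=> nu0 la0; pose B := enorm R q ^+ 2.
have B0 : 0 <= B by rewrite sqr_ge0.
exists (2 * (1 + nu * B / lambda) / nu + lambda^-1) => [|n].
  rewrite ltr_wpDl ?invr_gt0 // divr_ge0 ?(ltW nu0) //.
  by rewrite mulr_ge0 // addr_ge0 // divr_ge0 ?(ltW la0) // mulr_ge0 // ltW.
have low : n%:~R ^+ 2 <= 2 * mode n + 2 * B.
  apply: (@le_trans _ _ (n%:~R ^+ 2 * enorm R p ^+ 2)).
    by rewrite ler_peMr ?sqr_ge0 ?enorm2_p_ge1.
  rewrite mode_norm2E /B !enorm_sq.
  set p1 : R := p.1%:~R; set p2 : R := p.2%:~R.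
  set q1 : R := q.1%:~R; set q2 : R := q.2%:~R; set x : R := n%:~R.
  have := sqr_ge0 (q1 + (q1 + p1 * x)).
  have := sqr_ge0 (q2 + (q2 + p2 * x)); lra.
have M0 : 0 < mode n by exact: mode_norm2_gt0.
set X := nu * mode n + lambda.
have numode : 0 < nu * mode n by rewrite mulr_gt0.
have Xl : lambda <= X by rewrite /X; lra.
have Xb : nu * n%:~R ^+ 2 <= 2 * (1 + nu * B / lambda) * X.
  have : nu * B / lambda * lambda <= nu * B / lambda * X.
    by rewrite ler_wpM2l // divr_ge0 ?(ltW la0) // mulr_ge0 // ltW.
  rewrite divfK ?gt_eqF // => XB.
  have := ler_wpM2l (ltW nu0) low; rewrite /X in XB *; lra.
have X1 : 1 <= lambda^-1 * X by rewrite mulrC ler_pdivlMr ?mul1r.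
rewrite mulrDl addrC lerD //.
by rewrite mulrAC ler_pdivlMr // mulrC.
Qed.

End LatticeNorms.

(** * Finite-dimensional spaces of sequences *)

Section FiniteDimension.
Context {R : realType}.
Implicit Types (w : int -> R[i]) (V : set (int -> R[i])).

Definition independent m (v : 'I_m -> int -> R[i]) :=
  forall c : 'I_m -> R[i], \sum_(i < m) c i *: v i = 0 -> forall i, c i = 0.

Lemma sum_scale_at m (c : 'I_m -> R[i]) (v : 'I_m -> int -> R[i]) n :
  (\sum_(i < m) c i *: v i) n = \sum_(i < m) c i * v i n.
Proof. by rewrite fct_sumE. Qed.

Lemma sum_scale_in V m (c : 'I_m -> R[i]) (v : 'I_m -> int -> R[i]) :
  V 0 -> (forall a u w, V u -> V w -> V (a *: u + w)) ->
  (forall i, V (v i)) -> V (\sum_(i < m) c i *: v i).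
Proof.
move=> V0 VD Vv; elim/big_ind: _ => // [u w Vu Vw|i _].
  by rewrite -[u]scale1r; apply: VD.
by rewrite -[_ *: _]addr0; apply: VD.
Qed.

(** Sampling at the points [e] is injective on [V], so it maps an
    independent family to independent rows of length [r]. *)
Lemma independent_size_le V r (e : 'I_r -> int) m (v : 'I_m -> int -> R[i]) :
  V 0 -> (forall a u w, V u -> V w -> V (a *: u + w)) ->
  (forall w, V w -> (forall i, w (e i) = 0) -> w = 0) ->
  (forall i, V (v i)) -> independent v -> (m <= r)%N.
Proof.
move=> V0 VD Ve Vv indep; pose A := \matrix_(i < m, j < r) v i (e j).
suff /eqP <- : row_free A by apply: rank_leq_col.
apply: inj_row_free => c cA0; apply/rowP => i; rewrite mxE.
apply: (indep (fun i => c 0 i)); apply: Ve => [|j]; first exact: sum_scale_in.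
rewrite sum_scale_at; have /rowP/(_ j) := cA0; rewrite !mxE => cAj.
rewrite -[RHS]cAj; by apply: eq_bigr => k _; rewrite mxE.
Qed.

Lemma independent_extend m (v : 'I_m -> int -> R[i]) w :
  independent v -> ~ (exists c : 'I_m -> R[i], w = \sum_(i < m) c i *: v i) ->
  independent (fun i : 'I_m.+1 => oapp v w (unlift ord0 i)).
Proof.
move=> indep wspan c; rewrite big_ord_recl unlift_none /=.
under eq_bigr do rewrite liftK /=.
move=> c0E; have c0 : c ord0 = 0.
  apply/eqP/negPn/negP => c0; apply: wspan.
  exists (fun i => - (c ord0)^-1 * c (lift ord0 i)).
  move/eqP: c0E; rewrite addr_eq0 => /eqP c0E.
  rewrite -[w](scalerK c0) c0E scalerN -scaleNr scaler_sumr.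
  by apply: eq_bigr => i _; rewrite scalerA.
move: c0E; rewrite c0 scale0r add0r => /indep c1 i.
by case: (unliftP ord0 i) => [j ->|->].
Qed.

(** If no independent family spanned [V], each one could be extended by
    one more vector, eventually exceeding the number of coordinates. *)
Lemma has_dim_of_coordinates V r (e : 'I_r -> int) :
  V 0 -> (forall a u w, V u -> V w -> V (a *: u + w)) ->
  (forall w, V w -> (forall i, w (e i) = 0) -> w = 0) ->
  exists m, has_dim V m.
Proof.
move=> V0 VD Ve; apply: contrapT => nodim.
have big m : exists v : 'I_m -> int -> R[i], (forall i, V (v i)) /\ independent v.
  elim: m => [|m [v [Vv indep]]].
    by exists (fun _ => 0); split => // c _ [].
  have [w Vw wspan] : exists2 w, V w &
      ~ (exists c : 'I_m -> R[i], w = \sum_(i < m) c i *: v i).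
    apply: contrapT => nw; apply: nodim; exists m, v; split => // w Vw.
    by apply: contrapT => ?; apply: nw; exists w.
  exists (fun i => oapp v w (unlift ord0 i)); split.
    by move=> i; case: (unlift ord0 i) => [j|] /=.
  exact: independent_extend.
have [v [Vv indep]] := big r.+1.
by have := independent_size_le V0 VD Ve Vv indep; rewrite ltnn.
Qed.

End FiniteDimension.

(** * Riesz theory in the sup norm *)

Section FiniteAscent.
Context {R : realType}.
Local Notation seqZ := (int -> R[i]).
Local Notation normc := (@Normc.normc R).
Implicit Types u v w x y : seqZ.

Definition bounded_seq w := exists B : R, forall n, normc (w n) <= B.

(** A form of compactness of [T] for the sup norm, phrased so that it applies
    directly to the sequence of almost orthogonal vectors below. *)
Definition image_totally_bounded (T : seqZ -> seqZ) :=
  forall x : nat -> seqZ, (forall k n, normc (x k n) <= 1) ->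
  forall e : R, 0 < e ->
  exists j k, (j < k)%N /\ forall n, normc (T (x k) n - T (x j) n) <= e.

Lemma bounded_seq_lin (a : R[i]) u w : bounded_seq u -> bounded_seq w ->
  bounded_seq (a *: u + w).
Proof.
move=> [B uB] [B' wB]; exists (normc a * B + B') => n.
apply: le_trans (normcD _ _) _; rewrite Normc.normcM.
by rewrite lerD // ler_wpM2l // normc_ge0.
Qed.

Variables (T : seqZ -> seqZ) (z : R[i]) (C : R).
Hypothesis T_linear : forall (a : R[i]) u v, T (a *: u + v) = a *: T u + T v.
Hypothesis C_ge0 : 0 <= C.
Hypothesis T_bound : forall w b, (forall n, normc (w n) <= b) ->
  forall n, normc (T w n) <= C * b.
Local Notation A := (fun u => T u - z *: u).

Lemma shifted_linear k (a : R[i]) u v :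
  iter k A (a *: u + v) = a *: iter k A u + iter k A v.
Proof.
elim: k => [//|k IHk]; rewrite !iterS IHk T_linear.
by rewrite scalerDr scalerA [z * a]mulrC -scalerA opprD addrACA -scalerBr.
Qed.

Lemma shifted_bound w b : (forall n, normc (w n) <= b) ->
  forall n, normc (A w n) <= (C + normc z) * b.
Proof.
move=> wb n; apply: le_trans (normcB _ _) _.
by rewrite mulrDl lerD ?T_bound // Normc.normcM ler_wpM2l ?normc_ge0.
Qed.

Lemma shifted_iter_bound k w b : (forall n, normc (w n) <= b) ->
  forall n, normc (iter k A w n) <= (C + normc z) ^+ k * b.
Proof.
move=> wb; elim: k => [|k IHk] n; first by rewrite mul1r.
by rewrite iterS exprS -mulrA; apply: shifted_bound.
Qed.

Lemma bounded_shifted k w : bounded_seq w -> bounded_seq (iter k A w).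
Proof. by move=> [b wb]; eexists; apply: shifted_iter_bound wb. Qed.

Lemma bounded_image w : bounded_seq w -> bounded_seq (T w).
Proof. by move=> [b wb]; eexists; apply: T_bound wb. Qed.

Lemma iter_shifted0 k : iter k A 0 = 0.
Proof.
have := @shifted_linear k 1 0 0.
rewrite !scale1r addr0 => /eqP.
by rewrite -subr_eq0 opprD addNKr oppr_eq0 => /eqP.
Qed.

Lemma iter_shifted_leq j k w : (j <= k)%N -> iter j A w = 0 -> iter k A w = 0.
Proof. by move=> jk wj; rewrite -(subnK jk) iterD wj iter_shifted0. Qed.

(** Riesz's lemma for the inclusion ker A^k < ker A^(k+1) in the sup norm.
    The distance from [y] to ker A^k is positive because A^k is bounded and
    does not kill [y]; subtracting a nearly closest element and normalizing
    gives [x]. *)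
Lemma riesz_almost_orthogonal k y : bounded_seq y ->
  iter k.+1 A y = 0 -> iter k A y <> 0 ->
  exists x, [/\ forall n, normc (x n) <= 1, iter k.+1 A x = 0 &
    forall v, bounded_seq v -> iter k A v = 0 ->
      exists n, 2^-1 < normc (x n - v n)].
Proof.
move=> yB yk1 yk.
pose D : set R := [set r | exists v, [/\ bounded_seq v, iter k A v = 0 &
  forall n, normc (y n - v n) <= r]].
have [m ykm] : exists m, iter k A y m != 0.
  apply: contrapT => ykE; apply: yk; apply: funext => m.
  by apply/eqP/negPn/negP => ykm; apply: ykE; exists m.
have Cz0 : 0 <= C + normc z by rewrite addr_ge0 ?normc_ge0.
pose delta := normc (iter k A y m) / ((C + normc z) ^+ k + 1).
have delta_gt0 : 0 < delta.
  by rewrite divr_gt0 ?normc_gt0 // ltr_wpDl // exprn_ge0.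
have D_low r : D r -> delta <= r.
  move=> [v [_ vk yv]].
  rewrite ler_pdivrMr ?ltr_wpDl ?exprn_ge0 //.
  have r0 : 0 <= r by apply: le_trans (yv 0); apply: normc_ge0.
  have := @shifted_iter_bound k (y - v) r yv m.
  have -> : y - v = (-1) *: v + y by rewrite scaleN1r addrC.
  rewrite shifted_linear vk scaler0 add0r => /le_trans; apply.
  by rewrite mulrC ler_wpM2l // lerDl.
have infD : has_inf D.
  split; last by exists delta => r /D_low.
  have [B yb] := yB; exists B, 0; split => //.
  - by exists 0 => n; rewrite Normc.normc0.
  - exact: iter_shifted0.
  - by move=> n; rewrite subr0.
have inf_gt0 : 0 < inf D.
  apply: lt_le_trans delta_gt0 _; apply: lb_le_inf; first by case: infD.
  by move=> r /D_low.
have [r [v [vB vk yv]] r_lt] := inf_adherent inf_gt0 infD.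
have r_gt0 : 0 < r.
  by apply: lt_le_trans delta_gt0 (D_low _ _); exists v.
exists ((r^-1)%:C *: (y - v)).
have xE n : ((r^-1)%:C *: (y - v)) n = (r^-1)%:C * (y n - v n) by [].
have yvE : y - v = (-1) *: v + y by rewrite scaleN1r addrC.
split=> [n||u uB uk].
- rewrite xE normc_realM gtr0_norm ?invr_gt0 // mulrC.
  by rewrite ler_pdivrMr // mul1r.
- rewrite -[X in iter _ _ X]addr0 shifted_linear iter_shifted0 addr0.
  rewrite yvE shifted_linear yk1 addr0.
  by rewrite (iter_shifted_leq (leqnSn k) vk) !scaler0.
apply: contrapT => close.
have : D (r / 2).
  exists (r%:C *: u + v); split.
  - exact: bounded_seq_lin.
  - by rewrite shifted_linear uk vk scaler0 addr0.
  move=> n.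
  have -> : y n - (r%:C *: u + v) n = r%:C * ((r^-1)%:C * (y n - v n) - u n).
    rewrite mulrBr mulrA -rmorphM divff ?gt_eqF // mul1r.
    by rewrite /= opprD addrA addrAC.
  rewrite normc_realM gtr0_norm // ler_pM2l // leNgt; apply/negP => lt_n.
  by case: close; exists n.
move/(ge_inf infD.2); lra.
Qed.


Hypothesis z_neq0 : z != 0.

(** If the kernels kept growing, Riesz's lemma would provide unit vectors x_k;
    for j < k, T x_k - T x_j = z (x_k - v) with v in ker A^k, so the images
    would stay |z| / 2 apart, against total boundedness. *)
Lemma finite_ascent : image_totally_bounded T ->
  exists k, forall j w, bounded_seq w -> iter j A w = 0 -> iter k A w = 0.
Proof.
move=> Tcpt; apply: contrapT => asc.
have jump k : exists y, [/\ bounded_seq y, iter k.+1 A y = 0 & iter k A y <> 0].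
  apply: contrapT => nojump; apply: asc; exists k => j w wB.
  elim: j w wB => [|j IHj] w wB wj.
    exact: iter_shifted_leq wj.
  have [jk|kj] := leqP j.+1 k; first exact: iter_shifted_leq wj.
  apply: IHj => //; apply: contrapT => wj'; apply: nojump.
  exists (iter (j - k) A w); split; first exact: bounded_shifted.
    by rewrite -iterD addSn subnKC.
  by rewrite -iterD subnKC.
have unit k : exists x, [/\ forall n, normc (x n) <= 1, iter k.+1 A x = 0 &
    forall v, bounded_seq v -> iter k A v = 0 ->
      exists n, 2^-1 < normc (x n - v n)].
  by have [y [yB yk1 yk]] := jump k; apply: riesz_almost_orthogonal yk1 yk.
have [x xP] := choice unit.
have z0 : 0 < normc z by rewrite normc_gt0.
have [|j [k [jk close]]] := Tcpt x (fun k n => let: And3 h _ _ := xP k in h n) (normc z / 2).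
  by rewrite divr_gt0.
have xB i : bounded_seq (x i) by exists 1; case: (xP i).
have [_ xj _] := xP j; have [_ xk xfar] := xP k.
(* T x_k - T x_j = z (x_k - v), and A^k kills v because j < k. *)
pose v := z^-1 *: (T (x j) - A (x k)).
have Txj : T (x j) = z *: x j + A (x j) by rewrite addrC subrK.
have vE : v = z^-1 *: ((-1) *: A (x k) + (z *: x j + A (x j))).
  by rewrite /v scaleN1r -Txj [X in _ = _ *: X]addrC.
have xj' : iter k A (x j) = 0 by apply: iter_shifted_leq xj.
have vB : bounded_seq v.
  rewrite /v -[X in bounded_seq X]addr0; apply: bounded_seq_lin; last first.
    by exists 0 => n; rewrite Normc.normc0.
  rewrite -scaleN1r addrC; apply: bounded_seq_lin; last exact: bounded_image.
  exact: (@bounded_shifted 1 (x k)).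
have vk : iter k A v = 0.
  rewrite vE -[X in iter k A X]addr0 !shifted_linear iter_shifted0 xj' -!iterSr xk.
  rewrite (iter_shifted_leq (leqnSn k) xj').
  by rewrite !scaler0 !addr0 scaler0.
have [n] := xfar v vB vk; apply/negP; rewrite -leNgt.
have diff : T (x k) n - T (x j) n = z * (x k n - v n).
  rewrite mulrBr.
  have -> : v n = z^-1 * (T (x j) n - (T (x k) n - z * x k n)) by [].
  rewrite mulVKf //; ring.
rewrite -(ler_pM2l z0) -Normc.normcM -diff.
by apply: le_trans (close n) _; lra.
Qed.

End FiniteAscent.

(** * Tridiagonal operators with decaying rows *)

Section Tridiagonal.
Context {R : realType}.
Local Notation seqZ := (int -> R[i]).
Local Notation normc := (@Normc.normc R).
Implicit Types (u v w : seqZ) (d r : int -> R).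

Lemma nat_pigeonhole (F : finType) (f : nat -> F) :
  exists j k, (j < k)%N /\ f j = f k.
Proof.
apply: contrapT => nojk.
have inj : injective (fun i : 'I_#|F|.+1 => f i).
  move=> i j /= fij; apply/val_inj; case: (ltngtP i j) => // ij; case: nojk.
    by exists (val i), (val j); split.
  by exists (val j), (val i); split.
by have := leq_card _ inj; rewrite card_ord ltnn.
Qed.

(** Cells of width 1 / (Q + 1) partition [-1, 1]. *)
Lemma truncn_cell (Q : nat) (s t : R) : -1 <= s <= 1 -> -1 <= t <= 1 ->
  Num.truncn ((s + 1) * Q.+1%:R) = Num.truncn ((t + 1) * Q.+1%:R) ->
  `|s - t| <= Q.+1%:R^-1.
Proof.
move=> /andP[s1 _] /andP[t1 _] st; set q : R := Q.+1%:R in st *.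
have q0 : 0 < q by rewrite ltr0n.
have := @truncn_itv R ((s + 1) * q); have := @truncn_itv R ((t + 1) * q).
rewrite st -addn1 natrD; move: (_%:R : R) => m.
move=> /(_ _)/andP[|tm tM]; first by rewrite mulr_ge0 ?(ltW q0) //; lra.
move=> /(_ _)/andP[|sm sM]; first by rewrite mulr_ge0 ?(ltW q0) //; lra.
rewrite -[q^-1]mul1r ler_pdivlMr // -{1}(gtr0_norm q0) -normrM ler_norml.
lra.
Qed.

(** Each entry is coded by the cells of its real and imaginary parts, so the
    entries in a window take finitely many codes. *)
Lemma window_pigeonhole (x : nat -> seqZ) (N : nat) (eta : R) :
  (forall k n, normc (x k n) <= 1) -> 0 < eta ->
  exists j k, (j < k)%N /\
    forall n : int, (`|n| <= N)%N -> normc (x k n - x j n) <= eta.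
Proof.
move=> x1 eta0; pose Q := Num.truncn (2 / eta).
pose cell (t : R) : 'I_(2 * Q.+1).+1 := inord (Num.truncn ((t + 1) * Q.+1%:R)).
have cellP s t : -1 <= s <= 1 -> -1 <= t <= 1 -> cell s = cell t ->
    `|s - t| <= eta / 2.
  move=> s1 t1 /(congr1 val).
  have small (y : R) : -1 <= y <= 1 -> (Num.truncn ((y + 1) * Q.+1%:R) < (2 * Q.+1).+1)%N.
    move=> /andP[y0 y1]; rewrite ltnS.
    have : (y + 1) * Q.+1%:R <= (2 * Q.+1)%:R by rewrite natrM ler_wpM2r //; lra.
    by move=> /le_truncn; rewrite natrK.
  rewrite /= !inordK ?small // => /(truncn_cell s1 t1) /le_trans; apply.
  rewrite -[eta / 2]invrK invf_div lef_pV2 ?posrE ?divr_gt0 //.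
  exact/ltW/truncnS_gt.
pose pt (i : 'I_(2 * N).+1) : int := i%:Z - N%:Z.
pose code k := [ffun i => (cell (complex.Re (x k (pt i))),
                           cell (complex.Im (x k (pt i))))].
have [j [k [jk /ffunP code_jk]]] := nat_pigeonhole code.
exists j, k; split=> // n nN.
have [i ->] : exists i, n = pt i.
  have lt_i : (`|(n + N%:Z)%R| < (2 * N).+1)%N by lia.
  by exists (Ordinal lt_i); rewrite /pt /=; lia.
have coord (f : R[i] -> R) l m : (forall y, `|f y| <= normc y) -> -1 <= f (x l m) <= 1.
  by move=> fle; rewrite -ler_norml (le_trans (fle _)).
have := code_jk i; rewrite !ffunE => -[/cellP reP /cellP imP].
have {}reP := reP (coord _ _ _ (@Re_le_normc R)) (coord _ _ _ (@Re_le_normc R)).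
have {}imP := imP (coord _ _ _ (@Im_le_normc R)) (coord _ _ _ (@Im_le_normc R)).
apply: le_trans (normc_le_ReIm _) _.
have -> : eta = eta / 2 + eta / 2 by field.
rewrite raddfB raddfB /= distrC lerD //.
by rewrite distrC.
Qed.

(** With r = rho and d_n = - 1 / (nu |q + n p|^2 + lambda) this is the operator
    K of the determinant. *)
Definition tridiag d r w : seqZ := fun n =>
  (d n)%:C * ((r (n - 1))%:C * w (n - 1) - (r (n + 1))%:C * w (n + 1)).

Lemma tridiag_linear d r (a : R[i]) u v :
  tridiag d r (a *: u + v) = a *: tridiag d r u + tridiag d r v.
Proof.
apply: funext => n; rewrite /tridiag.
have E m : (a *: u + v) m = a * u m + v m by [].
rewrite !E.
have -> : forall f g : seqZ, (a *: f + g) n = a * f n + g n by [].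
ring.
Qed.

Variables (d r : int -> R) (D M : R).
Hypothesis r_bound : forall n, `|r n| <= M.
Hypothesis d_decay : forall n : int, (1 + n%:~R ^+ 2) * `|d n| <= D.

Let M_ge0 : 0 <= M.
Proof. exact: le_trans (r_bound 0). Qed.

Let D_ge0 : 0 <= D.
Proof.
by apply: le_trans (d_decay 0); rewrite mulr_ge0 // addr_ge0 // sqr_ge0.
Qed.

Lemma tridiag_at w n b : normc (w (n - 1)) <= b -> normc (w (n + 1)) <= b ->
  normc (tridiag d r w n) <= `|d n| * (2 * M * b).
Proof.
move=> b1 b2; rewrite normc_realM ler_wpM2l //.
apply: le_trans (normcB _ _) _; rewrite !normc_realM.
have -> : 2 * M * b = M * b + M * b by ring.
by rewrite lerD // ler_pM // normc_ge0.
Qed.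

Let d_bound n : `|d n| <= D.
Proof.
apply: le_trans (d_decay n); rewrite ler_peMl // lerDl.
exact: sqr_ge0.
Qed.

Lemma tridiag_bound w b : (forall n, normc (w n) <= b) ->
  forall n, normc (tridiag d r w n) <= (D * (2 * M)) * b.
Proof.
move=> wb n; apply: le_trans (tridiag_at (wb _) (wb _)) _.
rewrite -[X in _ <= X]mulrA ler_wpM2r // mulr_ge0 ?mulr_ge0 //.
exact: le_trans (normc_ge0 _) (wb n).
Qed.

(** Rows far from the origin are small because of the decay of [d]; the
    remaining ones only involve the entries in a finite window. *)
Lemma tridiag_totally_bounded : image_totally_bounded (tridiag d r).
Proof.
move=> x x1 e e0.
pose N := Num.truncn (D * (2 * M) * 2 / e).
pose eta := e / (D * (2 * M) + 1).
have DM0 : 0 <= D * (2 * M) by rewrite !mulr_ge0.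
have eta0 : 0 < eta by rewrite divr_gt0 // ltr_wpDl.
have [j [k [jk close]]] := window_pigeonhole N.+2 x1 eta0.
exists j, k; split=> // n.
have -> : tridiag d r (x k) n - tridiag d r (x j) n
    = tridiag d r (x k - x j) n.
  have -> : x k - x j = (-1) *: x j + x k by rewrite scaleN1r addrC.
  by rewrite tridiag_linear scaleN1r addrC.
(* The window has radius N + 2 because row n involves entries n - 1 and n + 1. *)
have [nN|Nn] := leqP `|n| N.+1.
  apply: le_trans (tridiag_at (b := eta) _ _) _.
  - by apply: close; lia.
  - by apply: close; lia.
  apply: (@le_trans _ _ (D * (2 * M) * eta)).
    rewrite -[X in _ <= X]mulrA ler_wpM2r //.
    by apply: mulr_ge0 (ltW eta0); rewrite mulr_ge0.
  rewrite mulrCA ler_piMr ?(ltW e0) // ler_pdivrMr ?mul1r ?lerDl //.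
  exact: ltr_wpDl.
have two m : normc ((x k - x j) m) <= 2.
  by apply: le_trans (normcB _ _) _; rewrite -[2]/(1 + 1) lerD.
apply: le_trans (tridiag_at (two _) (two _)) _.
have lt_eN : D * (2 * M) * 2 / e < `|n|%:~R.
  apply: lt_trans (truncnS_gt _) _; rewrite -/N.
  by rewrite -[_%:R]/((N.+1)%:~R) ltr_int; lia.
rewrite ltr_pdivrMr // in lt_eN.
have le_dn : `|n|%:~R * `|d n| <= D.
  apply: le_trans (d_decay n); rewrite ler_wpM2r //.
  rewrite intr_norm -[_ ^+ 2](@real_normK R) ?num_real //.
  by have := sqr_ge0 (`|n%:~R : R| - 1); have := normr_ge0 (n%:~R : R); nra.
have n0 : 0 < `|n|%:~R :> R by rewrite ltr0z; lia.
rewrite -(ler_pM2l n0) mulrA.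
apply: (@le_trans _ _ (D * (2 * M * 2))).
  by rewrite ler_wpM2r // !mulr_ge0.
by rewrite ltW // mulrA.
Qed.

End Tridiagonal.

(** * Multiplicities and the Fredholm determinant *)

Section Ell2Subspace.
Context {R : realType}.
Implicit Types u w : int -> R[i].
Local Notation normc := (@Normc.normc R).

Lemma ell2_0 : ell2 (0 : int -> R[i]).
Proof.
rewrite /ell2 /= esum1 // => n _.
have E : normc 0 ^+ 2 = 0 by rewrite Normc.normc0 expr0n.
by congr (_%:E).
Qed.

Lemma ell2D u w : ell2 u -> ell2 w -> ell2 (u + w).
Proof.
rewrite /ell2 /= => uf wf.
have sq0 (v : int -> R[i]) n : (0 <= (normc (v n) ^+ 2)%:E)%E.
  by rewrite lee_fin sqr_ge0.
pose f n := ((normc (u n) ^+ 2)%:E + (normc (w n) ^+ 2)%:E)%E.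
have f0 n : (0 <= f n)%E by apply: adde_ge0.
have ff : (\esum_(n in [set: int]) f n < +oo)%E.
  by rewrite esumD //; apply: lte_add_pinfty.
apply: (@le_lt_trans _ _ (\esum_(n in [set: int]) (f n + f n)%E)); last first.
  by rewrite esumD //; apply: lte_add_pinfty.
apply: le_esum => n _; rewrite /f -!EFinD lee_fin.
have := normcD (u n) (w n); have := normc_ge0 (u n + w n).
have -> : (u + w) n = u n + w n by [].
move: (normc (u n)) (normc (w n)) (normc _) => x y s s0 sxy.
have := sqr_ge0 (x - y); nra.
Qed.

Lemma ell2_le u w : (forall n, normc (u n) <= normc (w n)) -> ell2 w -> ell2 u.
Proof.
rewrite /ell2 /= => uw; apply: le_lt_trans; apply: le_esum => n _.
by rewrite lee_fin ler_sqr ?nnegrE ?normc_ge0.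
Qed.

Lemma ell2Z (a : R[i]) u : ell2 u -> ell2 (a *: u).
Proof.
move=> uf; pose N := Num.truncn (normc a).
have : ell2 (u *+ N.+1).
  elim: N.+1 => [|k IHk]; first by rewrite mulr0n; apply: ell2_0.
  by rewrite mulrS; apply: ell2D.
apply: ell2_le => n.
have -> : (u *+ N.+1) n = u n *+ N.+1.
  elim: N.+1 => [//|k IHk]; rewrite !mulrS -IHk //.
rewrite normcMn -mulr_natl Normc.normcM.
by rewrite ler_wpM2r ?normc_ge0 // ltW // truncnS_gt.
Qed.

End Ell2Subspace.

Section FiniteMultiplicity.
Context {R : realType}.
Local Notation seqZ := (int -> R[i]).
Implicit Types (u v w : seqZ).
Variables (d r : int -> R).
Hypotheses (d_neq0 : forall n, d n != 0) (r_neq0 : forall n, r n != 0).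
Local Notation T := (tridiag d r).

Lemma realC_eq0 (a : R) : (a%:C == 0 :> R[i]) = (a == 0).
Proof. exact: fmorph_eq0. Qed.

(** The eigenvector equation is a second-order recurrence whose leading
    coefficients in both directions are nonzero. *)
Lemma tridiag_two_zeros z w (a : int) : T w - z *: w = 0 ->
  w a = 0 -> w (a + 1) = 0 -> w = 0.
Proof.
move=> Tw wa wa1.
have rec n : (d n)%:C * ((r (n - 1))%:C * w (n - 1) - (r (n + 1))%:C * w (n + 1))
    = z * w n.
  have /(congr1 (fun f : seqZ => f n)) := Tw.
  by move/eqP; rewrite [_ == _]subr_eq0 => /eqP.
have up n : w n = 0 -> w (n + 1) = 0 -> w (n + 2) = 0.
  move=> w0 w1; have := rec (n + 1); rewrite w1 mulr0 addrK w0 mulr0 sub0r.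
  have -> : n + 1 + 1 = n + 2 by lia.
  move/eqP; rewrite mulf_eq0 oppr_eq0 mulf_eq0 !realC_eq0.
  by rewrite (negbTE (d_neq0 _)) (negbTE (r_neq0 _)) => /eqP.
have down n : w n = 0 -> w (n + 1) = 0 -> w (n - 1) = 0.
  move=> w0 w1; have := rec n; rewrite w0 mulr0 w1 mulr0 subr0.
  move/eqP; rewrite mulf_eq0 mulf_eq0 !realC_eq0.
  by rewrite (negbTE (d_neq0 _)) (negbTE (r_neq0 _)) => /eqP.
have right (k : nat) : w (a + k%:Z) = 0 /\ w (a + k%:Z + 1) = 0.
  elim: k => [|k [IH0 IH1]]; first by rewrite addr0.
  have -> : a + k.+1%:Z = a + k%:Z + 1 by lia.
  by split=> //; rewrite -addrA; apply: up.
have left (k : nat) : w (a - k%:Z) = 0 /\ w (a - k%:Z + 1) = 0.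
  elim: k => [|k [IH0 IH1]]; first by rewrite subr0.
  have -> : a - k.+1%:Z = a - k%:Z - 1 by lia.
  by split; [apply: down|rewrite subrK].
apply: funext => n; have [le_an|lt_na] := lerP a n.
  have [wn _] := right `|n - a|%N.
  by have {1}-> : n = a + `|n - a|%N%:Z by lia.
have [wn _] := left `|a - n|%N.
by have {1}-> : n = a - `|a - n|%N%:Z by lia.
Qed.

(** Applying T - z to a sequence vanishing on a window shrinks the window by
    one entry at each end, so 2 k zeros leave two zeros after k - 1 steps. *)
Lemma tridiag_window_inj z k w (a : int) :
  iter k (fun u => T u - z *: u) w = 0 ->
  (forall i : nat, (i < k.*2)%N -> w (a + i%:Z) = 0) -> w = 0.
Proof.
elim: k w a => [//|k IHk] w a; rewrite iterSr => Aw w0.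
apply: (@tridiag_two_zeros z w a).
- apply: (IHk _ (a + 1) Aw) => i ik.
  have -> : (T w - z *: w) (a + 1 + i%:Z) =
      T w (a + 1 + i%:Z) - z * w (a + 1 + i%:Z) by [].
  have i1 : (i.+1 < k.+1.*2)%N by lia.
  have i2 : (i.+2 < k.+1.*2)%N by lia.
  have := w0 _ i1; have := w0 _ i2; have := w0 _ (ltnW i1).
  rewrite /tridiag.
  have -> : a + 1 + i%:Z = a + i.+1%:Z by lia.
  have -> : a + i.+1%:Z - 1 = a + i%:Z by lia.
  have -> : a + i.+1%:Z + 1 = a + i.+2%:Z by lia.
  by move=> -> -> ->; rewrite !mulr0 subrr mulr0 subrr.
- by have := w0 0%N isT; rewrite addr0.
- by have := w0 1%N isT.
Qed.

Variables (D M : R).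
Hypothesis r_bound : forall n, `|r n| <= M.
Hypothesis d_decay : forall n : int, (1 + n%:~R ^+ 2) * `|d n| <= D.

(** By finite ascent the generalized eigenspace is contained in a single
    kernel, which is determined by the values at 2 k consecutive points. *)
Lemma tridiag_alg_mult z : z != 0 -> exists m, alg_mult T z m.
Proof.
move=> z0; have lin := @tridiag_linear R d r.
have [k ascent] : exists k, forall j w, bounded_seq w ->
    iter j (fun u => T u - z *: u) w = 0 ->
    iter k (fun u => T u - z *: u) w = 0.
  apply: (@finite_ascent R T z (D * (2 * M)) lin) => //.
  - have := d_decay 0; have := r_bound 0; have := sqr_ge0 ((0 : int)%:~R : R).
    have := normr_ge0 (d 0); have := normr_ge0 (r 0) => *.
    by rewrite mulr_ge0 //; nra.
  - exact: tridiag_bound.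
  - exact: tridiag_totally_bounded.
apply: (@has_dim_of_coordinates R _ k.*2 (fun i => 0 + i%:Z)).
- by split; [exact: ell2_0|exists 0%N].
- move=> a u w [uf [i ui]] [wf [j wj]]; split.
    by apply: ell2D => //; apply: ell2Z.
  exists k; rewrite shifted_linear //.
  rewrite (ascent _ _ (ell2_bounded uf) ui) (ascent _ _ (ell2_bounded wf) wj).
  by rewrite scaler0 addr0.
move=> w [wf [j wj]] w0.
apply: (tridiag_window_inj (k := k) (z := z) (a := 0)).
  exact: ascent (ell2_bounded wf) wj.
by move=> i ik; have := w0 (Ordinal ik).
Qed.

End FiniteMultiplicity.

Section FredholmDeterminant.
Context {R : realType}.
Variable T : (int -> R[i]) -> int -> R[i].

(** Every finite set of complex numbers containing - 1 contributes a zero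
    factor, so the net of products is eventually 0. *)
Lemma fredholm_det_eq0 w :
  (forall z, z != 0 -> exists m, alg_mult T z m) ->
  ell2 w -> w <> 0 -> T w = - w -> is_fredholm_det T 0.
Proof.
move=> mult wf w0 Tw.
have [m mP] : exists m : R[i] -> nat, forall z, z != 0 -> alg_mult T z (m z).
  have /choice[m mP] : forall z, exists k, z != 0 -> alg_mult T z k.
    move=> z; have [->|/mult[k kP]] := eqVneq z 0; first by exists 0%N.
    by exists k.
  by exists m.
have m1 : m (-1) != 0%N.
  apply/eqP => m10; have := mP (-1); rewrite oppr_eq0 oner_eq0 m10.
  move=> /(_ isT)[v [_ _ /(_ w)]]; case; last first.
    by move=> c; rewrite big_ord0.
  split=> //; exists 1%N => /=.
  by rewrite Tw scaleN1r opprK addNr.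
have totF := @summability.totally_filter R[i].
exists m; split => //; apply: cvg_near_cst.
have : summability.totally [set A : {fset R[i]} | -1 \in A].
  by exists [fset (-1 : R[i])]%fset => // A /= /fsubsetP; apply; rewrite inE.
apply: filterS => A /= A1.
apply/eqP; rewrite prodf_seq_eq0; apply/hasP; exists (-1) => //.
by rewrite oppr_eq0 oner_eq0 /= subrr expf_eq0 eqxx andbT lt0n.
Qed.

End FredholmDeterminant.

(** * Bounded solutions of the recurrence and roots of the equation *)

Section Solutions.
Context {R : realType}.
Implicit Types (c y : nat -> R) (b : R).

(** The ratios of consecutive terms are positive and satisfy the recursion of
    the continued fraction. *)
Lemma cfrac_of_positive_solution c y b : 0 < b -> (forall k, b <= c k) ->
  (forall k, 0 < y k) -> (forall k, y k = c k * y k.+1 + y k.+2) ->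
  y 1%N / y 0%N = cfrac c.
Proof.
move=> b0 bc y0 yE.
rewrite -(cfrac_unique (r := fun k => y k.+1 / y k) b0 bc) // => k.
  by rewrite divr_gt0.
rewrite (yE k).
have ck := lt_le_trans b0 (bc k).
have y1 := y0 k.+1; have y2 := y0 k.+2.
have cy := mulr_gt0 ck y1.
by field; rewrite !gt_eqF ?addr_gt0.
Qed.

(** The product of the successive tails solves the recurrence.  It is bounded
    because y_(k+2) <= y_k, whereas y_1 may exceed y_0. *)
Lemma cfrac_bounded_solution c b : 0 < b -> (forall k, b <= c k) ->
  exists y, [/\ y 0%N = 1, y 1%N = cfrac c,
    forall k, y k = c k * y k.+1 + y k.+2 &
    forall k, 0 < y k <= 1 + cfrac c].
Proof.
move=> b0 bc; pose F k := cfrac (fun j => c (j + k)%N).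
have bck k j : b <= c (j + k)%N by [].
have F0 k : 0 < F k := cfrac_gt0 b0 (bck k).
have FE k : F k = 1 / (c k + F k.+1).
  rewrite /F (cfrac_rec b0 (bck k)) add0n.
  by congr (1 / (c k + cfrac _)); apply: funext => j; rewrite addnS.
have cE : cfrac c = F 0%N.
  by congr cfrac; apply: funext => j; rewrite addn0.
pose y k := \prod_(i < k) F i.
have yS k : y k.+1 = y k * F k by rewrite /y big_ord_recr.
have y0 k : 0 < y k by apply: prodr_gt0.
have yE k : y k = c k * y k.+1 + y k.+2.
  have den : 0 < c k + F k.+1 by rewrite addr_gt0 // (lt_le_trans b0).
  by rewrite !yS (FE k); field; rewrite gt_eqF.
exists y; split=> //; first by rewrite /y big_ord0.
  by rewrite /y big_ord1 cE.
move=> k; rewrite y0 /=.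
have y00 : y 0%N = 1 by rewrite /y big_ord0.
(* y_(k+2) <= y_k ties each bound to the one two indices earlier. *)
have [] // : y k <= 1 + cfrac c /\ y k.+1 <= 1 + cfrac c.
elim: k => [|k [IH0 IH1]].
  by rewrite yS y00 mul1r cE; split; rewrite ?lerDl ?lerDr // ltW.
split=> //; apply: le_trans IH0; rewrite [X in _ <= X]yE lerDr.
by rewrite mulr_ge0 ?(ltW (y0 _)) // (le_trans (ltW b0)).
Qed.

End Solutions.

Section Roots.
Context {R : realType} (p q : int * int) (nu lambda : R).
Hypotheses (nu_gt0 : 0 < nu) (lambda_gt0 : 0 < lambda).
Hypotheses (p_neq0 : p <> 0) (q_type : type_I0 R p q).
Hypothesis q_nparallel : ~ parallel R q p.
Local Notation normc := (@Normc.normc R).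
Local Notation rho := (@rho R p q).
Local Notation mode := (@mode_norm2 R p q).
Local Notation a := (acoef p q nu lambda).
Local Notation K := (Kop p q nu lambda).
Implicit Types (n : int) (z x : int -> R) (w : int -> R[i]).

Let X n := nu * mode n + lambda.

Let X_gt0 n : 0 < X n.
Proof. by rewrite addr_gt0 // mulr_gt0 // mode_norm2_gt0. Qed.

Lemma acoef_ge n : n != 0 -> lambda <= a n.
Proof.
move=> n0; have /andP[r0 r1] := rho_in01 q_type p_neq0 n0.
rewrite /acoef addrC -/(X n) ler_pdivlMr //.
apply: (@le_trans _ _ lambda); first by rewrite ler_piMr // ltW.
by rewrite /X lerDr mulr_ge0 ?(ltW nu_gt0) // sqr_ge0.
Qed.

Let a_pos k : lambda <= a k.+1%:Z.
Proof. exact: acoef_ge. Qed.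

Let a_neg k : lambda <= a (- k.+1%:Z).
Proof. exact: acoef_ge. Qed.

Definition is_root := a 0 + fcf p q nu lambda + gcf p q nu lambda = 0.

(** The two half-line solutions take the value 1 at 0, and those on the
    left alternate in sign; the root equation is the recurrence at n = 0. *)
Lemma bounded_solution_of_root : is_root ->
  exists z B, [/\ z 0 = 1, forall n, z (n - 1) - z (n + 1) = a n * z n &
    forall n, `|z n| <= B].
Proof.
move=> root.
have [yp [yp0 yp1 ypE ypB]] := cfrac_bounded_solution lambda_gt0 a_pos.
have [ym [ym0 ym1 ymE ymB]] := cfrac_bounded_solution lambda_gt0 a_neg.
pose zm k := (-1) ^+ k * ym k.
pose z n := match n with Posz k => yp k | Negz k => zm k.+1 end.
have z_0 : z 0 = 1 by exact: yp0.
have z_1 : z 1 = fcf p q nu lambda by exact: yp1.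
have zN k : z (- k%:Z) = zm k.
  case: k => [|k]; first by rewrite oppr0 z_0 /zm ym0 mulr1.
  by rewrite -NegzE.
exists z, ((1 + fcf p q nu lambda) + (1 + gcf p q nu lambda)); split=> //.
  move=> n; have [n0|[[k ->]|[k ->]]] :
      n = 0 \/ (exists k : nat, n = k.+1%:Z) \/ (exists k : nat, n = - k.+1%:Z).
    case: n => [[|k]|k]; [by left|by right; left; exists k|].
    by right; right; exists k; rewrite NegzE.
  - rewrite n0 sub0r add0r (zN 1%N) /zm expr1 ym1 mulN1r z_1 z_0 mulr1.
    by move: root; rewrite /is_root /fcf /gcf; lra.
  - have -> : k.+1%:Z - 1 = k%:Z by lia.
    have -> : k.+1%:Z + 1 = k.+2%:Z by lia.
    by rewrite /z (ypE k) addrK.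
  have -> : - k.+1%:Z - 1 = - k.+2%:Z by lia.
  have -> : - k.+1%:Z + 1 = - k%:Z by lia.
  by rewrite !zN /zm (ymE k) !exprS; ring.
have Gp : 0 <= fcf p q nu lambda by apply: cfrac_ge0 lambda_gt0 a_pos.
have Gm : 0 <= gcf p q nu lambda by apply: cfrac_ge0 lambda_gt0 a_neg.
move=> [k|k].
  have /andP[y0 y1] := ypB k; rewrite /z ger0_norm ?ltW //.
  by move: y1; rewrite -/(fcf _ _ _ _); lra.
have /andP[y0 y1] := ymB k.+1.
rewrite /z /zm normrM normrX normrN1 expr1n mul1r ger0_norm ?(ltW y0) //.
by move: y1; rewrite -/(gcf _ _ _ _); lra.
Qed.

Lemma KopE w n : K w n = (- (X n)^-1)%:C *
  ((rho (n - 1))%:C * w (n - 1) - (rho (n + 1))%:C * w (n + 1)).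
Proof.
by have -> : - (X n)^-1 = (- nu * mode n - lambda)^-1
  by rewrite -invrN /X opprD mulNr.
Qed.

Lemma Kop_tridiag : K = tridiag (fun n => - (X n)^-1) rho.
Proof. by apply: funext => w; apply: funext => n; apply: KopE. Qed.

Lemma Kop_alg_mult t : t != 0 -> exists m, alg_mult K t m.
Proof.
rewrite Kop_tridiag => t0.
have [M rM] := rho_bounded q_type p_neq0.
have [C C0 XC] := mode_growth p_neq0 q_nparallel nu_gt0 lambda_gt0.
apply: (tridiag_alg_mult _ (rho_neq0 q_type p_neq0 q_nparallel) rM (D := C)) => // n.
  by rewrite oppr_eq0 invr_eq0 gt_eqF.
by rewrite normrN gtr0_norm ?invr_gt0 // ler_pdivrMr // XC.
Qed.

Lemma root_fredholm_det : is_root -> is_fredholm_det K 0.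
Proof.
move=> /bounded_solution_of_root[z [B [z0 zE zB]]].
have r0 n : rho n != 0 := rho_neq0 q_type p_neq0 q_nparallel n.
have wE n : z n / rho n = (X n)^-1 * (z (n - 1) - z (n + 1)).
  rewrite zE /acoef addrC -/(X n).
  by field; rewrite r0 gt_eqF.
pose w n := (z n / rho n)%:C.
apply: (fredholm_det_eq0 (w := w) Kop_alg_mult).
- have [C C0 XC] := mode_growth p_neq0 q_nparallel nu_gt0 lambda_gt0.
  apply: (@ell2_decay R w (C * (2 * B))) => n.
  have -> : normc (w n) = `|(X n)^-1 * (z (n - 1) - z (n + 1))|.
    by rewrite /w -[_%:C]mulr1 normc_realM Normc.normc1 mulr1 wE.
  rewrite normrM gtr0_norm ?invr_gt0 //.
  apply: (@le_trans _ _ (C * X n * ((X n)^-1 * `|z (n - 1) - z (n + 1)|))).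
    by rewrite ler_wpM2r ?XC // mulr_ge0 // ltW // invr_gt0.
  rewrite -mulrA mulVKf ?gt_eqF // ler_wpM2l ?(ltW C0) //.
  apply: le_trans (ler_normB _ _) _.
  by have := zB (n - 1); have := zB (n + 1); lra.
- move=> /(congr1 (fun f : int -> R[i] => f 0)) /eqP.
  rewrite /w z0 -[_ == _]/((_)%:C == 0) fmorph_eq0 div1r invr_eq0.
  by rewrite (negbTE (r0 0)).
apply: funext => n; rewrite KopE /w -!rmorphM -rmorphB -rmorphM.
rewrite mulrC [rho (n - 1) * _]mulrC [rho (n + 1) * _]mulrC !divfK ?r0 //.
by rewrite mulrN mulrC -wE rmorphN.
Qed.

(** Under these signs z_(n+1) / z_n on the right and - z_(-n-1) / z_(-n) on
    the left are positive, hence equal to the tails of f and g. *)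
Lemma root_of_signed_solution z : 0 < z 0 ->
  (forall k : nat, 0 < z k.+1%:Z) ->
  (forall k : nat, 0 < (-1) ^+ k * z (- k%:Z)) ->
  (forall n, z (n - 1) - z (n + 1) = a n * z n) -> is_root.
Proof.
move=> z0 zpos zneg zE.
have fE : z 1 / z 0 = fcf p q nu lambda.
  apply: (cfrac_of_positive_solution (y := fun k : nat => z k%:Z) lambda_gt0 a_pos).
    by case.
  move=> k; have := zE k.+1%:Z.
  have -> : k.+1%:Z - 1 = k%:Z by lia.
  have -> : k.+1%:Z + 1 = k.+2%:Z by lia.
  by move=> <-; rewrite subrK.
have gE : - z (- 1) / z 0 = gcf p q nu lambda.
  rewrite /gcf -(cfrac_of_positive_solution
    (y := fun k : nat => (-1) ^+ k * z (- k%:Z)) lambda_gt0 a_neg) //.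
    by rewrite oppr0 expr0 expr1 mul1r mulN1r.
  move=> k; have := zE (- k.+1%:Z).
  have -> : - k.+1%:Z - 1 = - k.+2%:Z by lia.
  have -> : - k.+1%:Z + 1 = - k%:Z by lia.
  rewrite !exprS; set s := _ ^+ k => E.
  have -> : a (- k.+1%:Z) * (-1 * s * z (- k.+1%:Z)) =
    - s * (a (- k.+1%:Z) * z (- k.+1%:Z)) by ring.
  rewrite -E; ring.
have := zE 0; rewrite sub0r add0r => E0.
rewrite /is_root -fE -gE.
have -> : a 0 = (z (-1) - z 1) / z 0 by rewrite E0 mulfK // gt_eqF.
by field; rewrite gt_eqF.
Qed.

Lemma eigenvector_recurrence w : LB p q nu w = lambda%:C *: w ->
  forall n, let z := fun n => rho n * complex.Re (w n) in
    z (n - 1) - z (n + 1) = a n * z n.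
Proof.
move=> /(congr1 (fun f : int -> R[i] => complex.Re (f _))) E n /=.
have := E n; rewrite /LB.
have -> : (lambda%:C *: w) n = lambda%:C * w n by [].
have ReB (u v : R[i]) : complex.Re (u - v) = complex.Re u - complex.Re v.
  by case: u v => u1 u2 [].
have ReM (s : R) (u : R[i]) : complex.Re (s%:C * u) = s * complex.Re u.
  by case: u => u1 u2 /=; rewrite mul0r subr0.
rewrite !ReB !ReM => {}E.
rewrite /acoef mulrA divfK; last exact: rho_neq0.
by move: E; lra.
Qed.

Lemma Re_gt0 (u : R[i]) : 0 < u -> 0 < complex.Re u.
Proof. by case: u => u1 u2 /=; rewrite ltcE /= => /andP[]. Qed.

Lemma root_of_eigenvector w : LB p q nu w = lambda%:C *: w ->
  sign_ineqs w -> is_root.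
Proof.
move=> Lw [wpos wm1 w0 wneg].
have r0 := rho0_lt0 q_type q_nparallel.
have rpos n (n0 : n != 0) : 0 < rho n by case/andP: (rho_in01 q_type p_neq0 n0).
have ReN (u : R[i]) : complex.Re (- u) = - complex.Re u by case: u.
have Re_lt0 (u : R[i]) : u < 0 -> complex.Re u < 0.
  by rewrite -oppr_gt0 => /Re_gt0; rewrite ReN oppr_gt0.
have Resign (k : nat) (u : R[i]) :
    complex.Re ((-1) ^+ k * u) = (-1) ^+ k * complex.Re u.
  by rewrite -(signr_odd _ k) -[in RHS](signr_odd _ k) !mulr_sign; case: (odd k).
apply: (@root_of_signed_solution (fun n => rho n * complex.Re (w n))).
- by rewrite nmulr_rgt0 // Re_lt0.
- by move=> k; rewrite mulr_gt0 ?rpos // Re_gt0 // wpos.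
- case=> [|[|k]].
  + by rewrite expr0 mul1r oppr0 nmulr_rgt0 // Re_lt0.
  + by rewrite expr1 mulN1r oppr_gt0 pmulr_rlt0 ?rpos // Re_lt0.
  have := wneg (- k.+2%:Z); rewrite abszN absz_nat => /(_ _)/Re_gt0.
  rewrite Resign mulrCA => wk; rewrite mulr_gt0 ?rpos //.
  by apply: wk; lia.
exact: eigenvector_recurrence.
Qed.

Lemma root_of_signed_eigenvector w : LB p q nu w = lambda%:C *: w ->
  sign_property w -> is_root.
Proof.
move=> Lw [|]; first exact: root_of_eigenvector.
apply: root_of_eigenvector.
rewrite scalerN -Lw; apply: funext => n.
have oppE (f : int -> R[i]) m : (- f) m = - f m by [].
rewrite oppE /LB !oppE; ring.
Qed.

End Roots.

Unset Implicit Arguments.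

Theorem theorem3p2 (R : realType) (nu : R) (p q : int * int)
    (nu_gt0 : 0 < nu) (p_neq0 : p <> 0) (q_in_Q : Qset R p q)
    (q_type : type_I0 R p q) (q_nparallel : ~ parallel R q p)
    (lambda : R) (lambda_gt0 : 0 < lambda) :
  (acoef p q nu lambda 0 + fcf p q nu lambda + gcf p q nu lambda = 0 ->
     is_fredholm_det (Kop p q nu lambda) 0) /\
  ((exists w : int -> R[i],
      is_eigenvector (@dom_LB R) (LB p q nu) lambda%:C w /\ sign_property w) ->
     (acoef p q nu lambda 0 + fcf p q nu lambda + gcf p q nu lambda = 0 <->
        is_fredholm_det (Kop p q nu lambda) 0)).
Proof.
split; first exact: root_fredholm_det.
move=> [w [[_ _ Lw] w_sign]]; split=> [|_]; first exact: root_fredholm_det.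
exact: root_of_signed_eigenvector Lw w_sign.
Qed.
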